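(* Let $q\ge1$ and $a$ be integers with $(a,q)=1$, let $N\ge1$ and $R\ge1$ be real, and let $\epsilon>0$ be fixed. Then $$\sum_{\substack{n\le N\\ n\equiv a\ (\mathrm{mod}\ q)}}\lambda_R^2(n)=\frac{N}{\phi(q)}\Big[\log R+c+O(v(q))+O\big(R^{-\frac12+\epsilon}\big)\Big]+O(R^2).$$
   Context: $\phi$ is Euler's totient function, $\mu$ the Möbius function, and $$\lambda_R(n)=\sum_{r\le R}\frac{\mu^2(r)}{\phi(r)}\sum_{d\mid (r,n)}d\,\mu(d).$$ The constant $c$ is $c=\gamma+\sum_p\frac{\log p}{p(p-1)}$, with $\gamma$ Euler's constant and the sum over all primes $p$; and $v(q)=\sum_{p\mid q}\frac{\log p}{p}$ (sum over primes dividing $q$), $v(1)=0$. The sum on the left is over positive integers $n$. Implied constants depend at most on $\epsilon$. *)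

(* Defs.v *)
From HB Require Import structures.
From mathcomp Require Import all_boot all_order all_algebra.
From mathcomp Require Import all_classical all_reals all_analysis.
Set Implicit Arguments.
Unset Strict Implicit.
Unset Printing Implicit Defensive.
Import Order.TTheory GRing.Theory Num.Theory.
Import numFieldNormedType.Exports.
Local Open Scope classical_set_scope.
Local Open Scope ring_scope.

Definition squarefree (n : nat) : bool :=
  (0 < n)%N && all (fun p => ~~ (p ^ 2 %| n)%N) (primes n).

Definition moebius (n : nat) : int :=
  if squarefree n then (-1) ^+ size (primes n) else 0.

(* The range 1 <= r <= R is encoded as 1 <= r < (Num.truncn R).+1, Num.truncn R
   being the integer part of R (and 0 when R < 0). *)
Definition lambda {K : realType} (R : K) (n : nat) : K :=
  \sum_(1 <= r < (Num.truncn R).+1)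
    (moebius r)%:~R ^+ 2 / (totient r)%:R *
    \sum_(d <- divisors (gcdn r n)) d%:R * (moebius d)%:~R.

Definition euler_gamma (K : realType) : K :=
  limn (fun n : nat => \sum_(1 <= k < n.+1) k%:R^-1 - ln n%:R : K).

Definition constc (K : realType) : K :=
  euler_gamma K +
  limn (fun n : nat =>
    \sum_(0 <= p < n | prime p) ln p%:R / (p%:R * (p%:R - 1)) : K).

Definition v (K : realType) (q : nat) : K :=
  \sum_(p <- primes q) ln p%:R / p%:R.

(* Main.v *)
Require Import Defs.
From HB Require Import structures.
From mathcomp Require Import all_boot all_order all_algebra.
From mathcomp Require Import all_classical all_reals all_analysis.
From mathcomp Require Import zify ring lra.
Set Implicit Arguments.
Unset Strict Implicit.
Unset Printing Implicit Defensive.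
Import Order.TTheory GRing.Theory Num.Theory.
Import numFieldNormedType.Exports.
Local Open Scope ring_scope.

(* Write w(r) = mu^2(r)/phi(r) and G(x) = sum_(r <= x) w(r).

   Expanding lambda_R^2 and counting the n <= N with n = a mod q and
   [d, e] | n, which number N/(q [d, e]) + O(1) when (de, q) = 1 and 0
   otherwise, gives an error O((sum_(r <= R) w(r) sigma(r))^2) = O(R^2).
   Since the sum of mu(d) mu(e) (d, e) over d | m and e | n, for squarefree m
   and n, is phi(m) if m = n and 0 otherwise, the main term is N/q times
   sum_(r <= R) w(r) sum_(s | q, s r' <= R) w(s), where r' is the largest
   divisor of r prime to q.
   Without the constraint s r' <= R this would be (q/phi(q)) G(R); as r' <= r,
   the terms it removes add up to at most
   sum_(s | q) w(s) (G(R) - G(R/s)) << sum_(s | q) w(s) log s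
                                     = (q/phi(q)) v(q).

   For the asymptotics of G, pass from the weights 1/m to w(m) one prime p at a
   time.  Since (1 - X/p) (1 + X/(p-1)) = 1 + (X - X^2)/(p (p-1)), replacing
   the Euler factor at p turns the summatory function F(x) into
   F(x) + (F(x/p) - F(x/p^2))/(p (p-1)).  The same recursion maps
   log x + c to log x + c + log p/(p (p-1)), and an error x^(-alpha) is
   multiplied by at most 1 + (p^alpha + p^(2 alpha))/(p (p-1)), the product of
   which over all p converges for alpha < 1/2. *)

(** * Squarefree numbers *)

Lemma squarefreeP (n : nat) :
  reflect ((0 < n)%N /\ forall p, prime p -> (logn p n <= 1)%N) (squarefree n).
Proof.
apply: (iffP andP) => -[n0 H]; split=> //.
  move=> p pp; case: (leqP (logn p n) 1) => // l2.
  have pn : p \in primes n by rewrite -logn_gt0 (leq_trans _ l2).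
  by move/allP: H => /(_ p pn); rewrite pfactor_dvdn// l2.
apply/allP => p; rewrite mem_primes => /andP[pp _].
by rewrite pfactor_dvdn// -ltnNge ltnS H.
Qed.

Lemma squarefree_gt0 n : squarefree n -> (0 < n)%N.
Proof. by case/andP. Qed.

Lemma squarefree_dvdn d n : (d %| n)%N -> squarefree n -> squarefree d.
Proof.
move=> dn /squarefreeP[n0 H]; apply/squarefreeP; split=> [|p pp].
  exact: dvdn_gt0 dn.
by apply: leq_trans (H p pp); apply: dvdn_leq_log.
Qed.

Lemma coprime_logn0 m n p : prime p -> (0 < m)%N -> (0 < n)%N -> coprime m n ->
  logn p m = 0 \/ logn p n = 0.
Proof.
move=> pp m0 n0 cmn; case: (boolP (p %| m)%N) => pm; last first.
  by left; rewrite lognE pp m0 (negPf pm).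
right; apply: logn_coprime; exact: coprime_dvdl pm cmn.
Qed.

Lemma squarefreeM m n : coprime m n ->
  squarefree (m * n) = squarefree m && squarefree n.
Proof.
move=> cmn; apply/idP/andP => [H|[/squarefreeP[m0 Hm] /squarefreeP[n0 Hn]]].
  by split; apply: squarefree_dvdn H; [apply: dvdn_mulr|apply: dvdn_mull].
apply/squarefreeP; split=> [|p pp]; first by rewrite muln_gt0 m0.
rewrite lognM//; have [->|->] := coprime_logn0 pp m0 n0 cmn.
  by rewrite add0n Hn.
by rewrite addn0 Hm.
Qed.

Lemma prime_squarefree p : prime p -> squarefree p.
Proof.
move=> pp; apply/squarefreeP; split=> [|r rp]; first exact: prime_gt0.
by rewrite logn_prime// leq_b1.
Qed.

Lemma primes_coprimeM m n : coprime m n -> (0 < m)%N -> (0 < n)%N ->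
  perm_eq (primes (m * n)) (primes m ++ primes n).
Proof.
move=> cmn m0 n0; apply: uniq_perm; first exact: primes_uniq.
  rewrite cat_uniq !primes_uniq andbT /=; apply/hasPn => p.
  rewrite !mem_primes m0 n0 => /and3P[pp _ pn]; apply/negP => /and3P[_ _ pm].
  have := coprime_dvdl pm (coprime_dvdr pn cmn).
  by rewrite /coprime gcdnn => /eqP p1; move: pp; rewrite p1.
by move=> p; rewrite mem_cat primesM.
Qed.

Lemma dvdn_squarefree d n : squarefree n ->
  (d %| n)%N = squarefree d && all (mem (primes n)) (primes d).
Proof.
move=> sn; apply/idP/andP => [dn|[sd /allP H]].
  split; first exact: squarefree_dvdn sn.
  apply/allP => p; rewrite !inE !mem_primes => /and3P[-> d0 pd].
  by rewrite squarefree_gt0//= (dvdn_trans pd).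
have d0 := squarefree_gt0 sd; have n0 := squarefree_gt0 sn.
apply/dvdn_partP => // p pd; have {}pd : p \in primes d by [].
rewrite p_part pfactor_dvdn //; last by move: pd; rewrite mem_primes => /and3P[].
move/squarefreeP : sd => [_ /(_ p)] Hl; apply: leq_trans (Hl _) _.
  by move: pd; rewrite mem_primes => /and3P[].
rewrite logn_gt0; exact: H.
Qed.

(** For distinct primes this enumerates, without repetition, the squarefree numbers built from them.
    Splitting on whether the first prime divides turns Euler products into an induction on the
    list. *)
Fixpoint sqprods (ps : seq nat) : seq nat :=
  if ps is p :: ps' then sqprods ps' ++ [seq p * s | s <- sqprods ps']%N
  else [:: 1%N].

Lemma mem_sqprods ps s : uniq ps -> all prime ps ->
  (s \in sqprods ps) = squarefree s && all (mem ps) (primes s).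
Proof.
elim: ps s => [|p ps IH] s.
  move=> _ _; rewrite inE; apply/eqP/andP => [->//|[/squarefree_gt0 s0 H]].
  suff : primes s == [::] by rewrite primes_eq0 => s2; lia.
  by case: (primes s) H.
move=> /= /andP[pps ups] /andP[pp aps]; rewrite mem_cat IH//.
have notp t : all (mem ps) (primes t) -> (0 < t)%N -> ~~ (p %| t)%N.
  move=> /allP H t0; apply/negP => pt; move: (H p).
  by rewrite mem_primes pp t0 pt => /(_ isT); apply/negP.
apply/orP/andP => [[/andP[-> /allP H]|/mapP[t]]|[ss /allP H]].
- by split=> //; apply/allP => r /H; rewrite !inE => ->; rewrite orbT.
- rewrite IH// => /andP[st at_] ->.
  have t0 := squarefree_gt0 st.
  have cpt : coprime p t by rewrite prime_coprime// notp.
  rewrite squarefreeM// st prime_squarefree//; split=> //.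
  apply/allP => r; rewrite primesM// ?prime_gt0// => /orP[].
    by rewrite primes_prime// !inE => ->.
  by move=> /(allP at_); rewrite !inE => ->; rewrite orbT.
case: (boolP (p %| s)%N) => ps_; last first.
  left; rewrite ss; apply/allP => r rs; move: (H r rs).
  rewrite !inE => /orP[/eqP E|//]; move: rs; rewrite mem_primes E.
  by rewrite (negPf ps_) !andbF.
right; apply/mapP; have [t E] := dvdnP ps_; rewrite mulnC in E.
exists t => //; rewrite IH//.
have s0 := squarefree_gt0 ss.
have t0 : (0 < t)%N by move: s0; rewrite E muln_gt0 => /andP[].
have npt : ~~ (p %| t)%N.
  apply/negP => pt; move/squarefreeP : ss => [_ /(_ p pp)].
  rewrite E lognM// ?prime_gt0// logn_prime// eqxx.
  have : (0 < logn p t)%N by rewrite logn_gt0 mem_primes pp t0.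
  lia.
move: ss; rewrite E squarefreeM ?prime_coprime// => /andP[_ ->] /=.
apply/allP => r rt; have : r \in primes s.
  by rewrite E primesM// ?prime_gt0//; apply/orP; right.
move=> /H; rewrite !inE => /orP[/eqP Er|//].
by move: rt; rewrite Er mem_primes (negPf npt) !andbF.
Qed.

Lemma sqprods_gt0 ps s : all prime ps -> s \in sqprods ps -> (0 < s)%N.
Proof.
elim: ps s => [|p ps IH] s /=; first by rewrite inE => _ /eqP->.
move=> /andP[pp aps]; rewrite mem_cat => /orP[/(IH _ aps)//|/mapP[t /(IH _ aps) t0 ->]].
by rewrite muln_gt0 prime_gt0.
Qed.

Lemma sqprods_ndvd p ps s : uniq (p :: ps) -> all prime (p :: ps) ->
  s \in sqprods ps -> ~~ (p %| s)%N.
Proof.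
move=> /= /andP[pps ups] /andP[pp aps] sp; have s0 := sqprods_gt0 aps sp.
move: sp; rewrite mem_sqprods// => /andP[_ /allP H].
apply/negP => pt; move: (H p).
by rewrite mem_primes pp s0 pt => /(_ isT); apply/negP.
Qed.

Lemma sqprods_uniq ps : uniq ps -> all prime ps -> uniq (sqprods ps).
Proof.
elim: ps => [//|p ps IH] ups aps.
have /andP[pps ups'] := ups; have /andP[pp aps'] := aps.
rewrite /= cat_uniq IH//= map_inj_uniq ?IH//; last first.
  by move=> x y /eqP; rewrite eqn_pmul2l ?prime_gt0// => /eqP.
rewrite andbT; apply/hasPn => x /mapP[t _ ->]; apply/negP => /=.
by move=> /(sqprods_ndvd ups aps); rewrite dvdn_mulr.
Qed.

Lemma primes_all_prime n : all prime (primes n).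
Proof. by apply/allP => p; rewrite mem_primes => /andP[]. Qed.

Lemma perm_divisors_sqprods n : squarefree n ->
  perm_eq (divisors n) (sqprods (primes n)).
Proof.
move=> sn; apply: uniq_perm; first exact: divisors_uniq.
  by rewrite sqprods_uniq ?primes_uniq// primes_all_prime.
move=> d; rewrite -dvdn_divisors ?squarefree_gt0//.
by rewrite mem_sqprods ?primes_uniq ?primes_all_prime// dvdn_squarefree.
Qed.

Lemma sum_sqprods (K : comNzRingType) (f : nat -> K) ps :
  uniq ps -> all prime ps -> f 1%N = 1 ->
  (forall p s, prime p -> squarefree s -> ~~ (p %| s)%N ->
     f (p * s)%N = f p * f s) ->
  \sum_(s <- sqprods ps) f s = \prod_(p <- ps) (1 + f p).
Proof.
move=> + + f1 fM; elim: ps => [|p ps IH] ups aps.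
  by rewrite /= big_seq1 big_nil.
have /andP[pps ups'] := ups; have /andP[pp aps'] := aps.
rewrite /= big_cat big_map big_cons /= -IH// mulrDl mul1r; congr (_ + _).
rewrite mulr_sumr !big_seq; apply: eq_bigr => s sp; apply: fM => //.
  by move: sp; rewrite mem_sqprods// => /andP[].
exact: sqprods_ndvd sp.
Qed.

(** * The Möbius function and its gcd sums *)

Lemma moebius1 : moebius 1 = 1. Proof. by []. Qed.

Lemma moebiusM m n : coprime m n -> moebius (m * n) = moebius m * moebius n.
Proof.
move=> cmn; rewrite /moebius squarefreeM//.
case: (boolP (squarefree m)) => sm /=; last by rewrite mul0r.
case: (boolP (squarefree n)) => sn /=; last by rewrite mulr0.
rewrite (perm_size (primes_coprimeM cmn _ _)) ?squarefree_gt0//.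
by rewrite size_cat exprD.
Qed.

Lemma moebius_prime p : prime p -> moebius p = -1.
Proof. by move=> pp; rewrite /moebius prime_squarefree// primes_prime. Qed.

Lemma moebius_sqr (K : nzRingType) n :
  (moebius n)%:~R ^+ 2 = (squarefree n)%:R :> K.
Proof.
rewrite /moebius; case: squarefree; last by rewrite expr0n.
by rewrite -rmorphXn /= exprAC sqrrN expr1n.
Qed.

Lemma totient_squarefree n : squarefree n ->
  totient n = (\prod_(p <- primes n) p.-1)%N.
Proof.
move=> /squarefreeP[n0 H]; rewrite totientE// !big_seq; apply: eq_bigr => p.
rewrite mem_primes => /andP[/H]; case: logn => [|[|]]//= _ _; exact: muln1.
Qed.

Lemma gcdnM_coprime d m n : coprime m n ->
  gcdn d (m * n) = (gcdn d m * gcdn d n)%N.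
Proof.
move=> cmn; apply/eqP; rewrite eqn_dvd; apply/andP; split.
  rewrite muln_gcdr dvdn_gcd dvdn_mull ?dvdn_gcdl//=.
  by rewrite muln_gcdl dvdn_gcd dvdn_gcdr andbT dvdn_mulr// dvdn_gcdl.
rewrite dvdn_gcd dvdn_mul ?dvdn_gcdr// andbT Gauss_dvd ?dvdn_gcdl//.
by apply: coprime_dvdl (dvdn_gcdr _ _) (coprime_dvdr (dvdn_gcdr _ _) cmn).
Qed.

(** The summand is multiplicative in e, so the sum is the product over p | n of 1 - (d, p). A prime
    p not dividing d gives the factor 0, and p | d gives 1 - p. *)
Lemma sum_moebius_gcd (K : comNzRingType) d n : squarefree n ->
  \sum_(e <- divisors n) (moebius e)%:~R * (gcdn d e)%:R =
  if (n %| d)%N then (moebius n)%:~R * (totient n)%:R else 0 :> K.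
Proof.
move=> sn; have n0 := squarefree_gt0 sn.
rewrite (perm_big _ (perm_divisors_sqprods sn)) /=.
rewrite (sum_sqprods (f := fun e => (moebius e)%:~R * (gcdn d e)%:R)); first last.
- move=> p s pp _ ps; have cps : coprime p s by rewrite prime_coprime.
  by rewrite moebiusM// gcdnM_coprime// rmorphM natrM /= mulrACA.
- by rewrite moebius1 gcdn1 mulr1.
- exact: primes_all_prime.
- exact: primes_uniq.
case: ifPn => nd; last first.
  (* As n is squarefree, its failure to divide d is witnessed by a prime; the Euler factor of that
     prime vanishes. *)
  have [p pn pd] : exists2 p, p \in primes n & ~~ (p %| d)%N.
    apply/hasP; apply: contraR nd; rewrite -all_predC => /allP H.
    apply/dvdn_partP => // p pn; have {}pn : p \in primes n by [].
    rewrite p_part.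
    have pp : prime p by move: pn; rewrite mem_primes => /and3P[].
    move/squarefreeP : sn => [_ /(_ p pp)].
    have : (0 < logn p n)%N by rewrite logn_gt0.
    case: logn => [|[|]]// _ _; rewrite expn1; have := H p pn; by rewrite /= negbK.
  rewrite (big_rem p)//=; move: pn; rewrite mem_primes => /and3P[pp _ _].
  have /eqP -> : coprime d p by rewrite coprime_sym prime_coprime.
  by rewrite moebius_prime// rmorphN1 mulr1 subrr mul0r.
rewrite totient_squarefree// natr_prod.
have -> : (moebius n)%:~R = \prod_(p <- primes n) (-1) :> K.
  by rewrite /moebius sn big_const_seq count_predT iter_mulr_1 rmorphXn rmorphN1.
rewrite -big_split /= !big_seq; apply: eq_bigr => p.
rewrite mem_primes => /and3P[pp _ pn].
rewrite moebius_prime// rmorphN1 !mulN1r.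
have /gcdn_idPr -> : (p %| d)%N by apply: dvdn_trans nd.
by rewrite -{1}(prednK (prime_gt0 pp)) -natr1 opprD addrC subrK.
Qed.

(* Only the d with n | d | m contribute, so by symmetry n = m. *)
Lemma sum_moebius_gcd2 (K : comNzRingType) m n : squarefree m -> squarefree n ->
  \sum_(d <- divisors m) \sum_(e <- divisors n)
     (moebius d)%:~R * (moebius e)%:~R * (gcdn d e)%:R =
  if m == n then (totient m)%:R else 0 :> K.
Proof.
move=> sm sn.
have main a b : squarefree a -> squarefree b ->
    \sum_(d <- divisors a) \sum_(e <- divisors b)
     (moebius d)%:~R * (moebius e)%:~R * (gcdn d e)%:R =
   \sum_(d <- divisors a) if (b %| d)%N then
       (moebius d)%:~R * ((moebius b)%:~R * (totient b)%:R) else 0 :> K.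
  move=> sa sb; apply: eq_bigr => d _.
  under eq_bigr do rewrite -mulrA.
  rewrite -mulr_sumr sum_moebius_gcd//.
  by case: ifP; rewrite ?mulr0.
have nz a b : squarefree a -> squarefree b -> ~~ (b %| a)%N ->
    \sum_(d <- divisors a) \sum_(e <- divisors b)
     (moebius d)%:~R * (moebius e)%:~R * (gcdn d e)%:R = 0 :> K.
  move=> sa sb ba; rewrite main// big_seq big1// => d.
  rewrite -dvdn_divisors ?squarefree_gt0// => da.
  case: ifP => // bd; case/negP: ba; exact: dvdn_trans da.
case: eqP => [<-|mn].
  rewrite main// (bigD1_seq m) ?divisors_uniq ?divisors_id ?squarefree_gt0//=.
  rewrite dvdnn mulrA -expr2 moebius_sqr sm mul1r big_seq_cond big1 ?addr0//.
  move=> d /andP[]; rewrite -dvdn_divisors ?squarefree_gt0// => dm dnm.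
  case: ifP => // md; case/eqP: dnm; apply/eqP; rewrite eqn_dvd dm; exact: md.
case: (boolP (n %| m)%N) => nm; last exact: nz.
rewrite exchange_big /=; under eq_bigr do under eq_bigr do
  rewrite (mulrC (_%:~R)) gcdnC.
apply: nz => //; apply/negP => mn'; apply: mn; apply/eqP.
by rewrite eqn_dvd mn'.
Qed.

(** * The weights mu^2(r)/phi(r) *)

(** The r' of the overview. *)
Local Notation coprime_part n q := (partn n (negn (pi_of q))).

Lemma dvdn_coprime_part d n q : (0 < n)%N -> (0 < q)%N ->
  (d %| (coprime_part n q))%N = (d %| n)%N && coprime d q.
Proof.
move=> n0 q0; apply/idP/andP => [dn|[dn cdq]].
  split; first exact: dvdn_trans dn (dvdn_part _ _).
  have d0 : (0 < d)%N by apply: dvdn_gt0 dn; exact: part_gt0.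
  by rewrite coprime_sym coprime_pi'// (pnat_dvd dn)// part_pnat.
have d0 := dvdn_gt0 n0 dn.
rewrite -(@part_pnat_id (\pi(q)^') d) ?partn_dvd//.
by rewrite -coprime_pi'// coprime_sym.
Qed.

Lemma sum_divisors_coprime (V : nmodType) (F : nat -> V) n q :
  (0 < n)%N -> (0 < q)%N ->
  \sum_(d <- divisors n | coprime d q) F d =
  \sum_(d <- divisors (coprime_part n q)) F d.
Proof.
move=> n0 q0; rewrite -big_filter; apply: perm_big; apply: uniq_perm.
- by rewrite filter_uniq// divisors_uniq.
- exact: divisors_uniq.
move=> d; rewrite mem_filter -!dvdn_divisors// ?part_gt0//.
by rewrite dvdn_coprime_part// andbC.
Qed.

(** The weight w of the overview: by [moebius_sqr], mu^2 is the indicator of squarefree numbers. *)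
Definition totient_weight (K : fieldType) (r : nat) : K :=
  (squarefree r)%:R / (totient r)%:R.
Arguments totient_weight {K} r.

Section TotientWeight.
Variable K : numFieldType.
Implicit Types (r s q : nat).
Notation w := (@totient_weight K).

Lemma totient_weight_ge0 r : 0 <= w r.
Proof. by rewrite divr_ge0. Qed.

Lemma totient_weight1 : w 1 = 1.
Proof. by rewrite /totient_weight divr1. Qed.

Lemma totient_weightM r s : coprime r s -> w (r * s) = w r * w s.
Proof.
move=> c; rewrite /totient_weight squarefreeM// totient_coprime// natrM invfM.
by rewrite mulrACA -natrM mulnb.
Qed.

Lemma totient_weight_prime p : prime p -> w p = (p%:R - 1)^-1.
Proof.
move=> pp; rewrite /totient_weight prime_squarefree// mul1r totient_prime//.
by rewrite -{2}(prednK (prime_gt0 pp)) -natr1 addrK.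
Qed.

Lemma sum_totient_weight ps : uniq ps -> all prime ps ->
  \sum_(s <- sqprods ps) w s = \prod_(p <- ps) (p%:R / (p%:R - 1)).
Proof.
move=> ups aps; rewrite sum_sqprods//; first last.
- by move=> p s pp ss ps_; rewrite totient_weightM// prime_coprime.
- exact: totient_weight1.
rewrite !big_seq; apply: eq_bigr => p pps.
have pp := allP aps p pps; rewrite totient_weight_prime//.
have : p%:R - 1 != 0 :> K by rewrite subr_eq0 pnatr_eq1 gtn_eqF// prime_gt1.
move=> H; field; exact: H.
Qed.

Lemma sum_totient_weight_primes q : (0 < q)%N ->
  \sum_(s <- sqprods (primes q)) w s = q%:R / (totient q)%:R.
Proof.
move=> q0; rewrite sum_totient_weight ?primes_uniq ?primes_all_prime//.
apply: (canRL (mulfK _)); first by rewrite pnatr_eq0 -lt0n totient_gt0.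
rewrite totientE// [in RHS](prod_prime_decomp q0) prime_decompE big_map /=.
rewrite !natr_prod -big_split /= !big_seq; apply: eq_bigr => p pq.
have pp : prime p by move: pq; rewrite mem_primes => /and3P[].
have : (0 < logn p q)%N by rewrite logn_gt0.
case: (logn p q) => // k _ /=.
have H : p%:R - 1 != 0 :> K by rewrite subr_eq0 pnatr_eq1 gtn_eqF// prime_gt1.
have E : p.-1%:R = p%:R - 1 :> K.
  by rewrite -{2}(prednK (prime_gt0 pp)) -natr1 addrK.
by rewrite expnS !natrM E mulrA mulfVK.
Qed.

(* Reindexing by the factorisation r = s * rho. *)
Lemma sum_totient_weight_part q rho m : (0 < q)%N -> squarefree rho ->
  coprime q rho ->
  \sum_(1 <= r < m.+1 | (coprime_part r q) == rho) w r * (totient rho)%:R =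
  \sum_(s <- sqprods (primes q) | (s * rho <= m)%N) w s.
Proof.
move=> q0 srho crho; have rho0 := squarefree_gt0 srho.
rewrite (bigID (fun r => squarefree r)) /= [X in _ + X]big1 ?addr0; last first.
  by move=> r /andP[_ /negPf sr]; rewrite /totient_weight sr mul0r mul0r.
rewrite -big_filter -[RHS]big_filter.
have sqpi s : s \in sqprods (primes q) ->
    [/\ squarefree s, \pi(q).-nat s & coprime s rho].
  rewrite mem_sqprods ?primes_uniq ?primes_all_prime// => /andP[ss /allP H].
  have sq : \pi(q).-nat s.
    apply/pnatP => [|p pp ps]; first exact: squarefree_gt0.
    by apply: (H p); rewrite mem_primes pp ps squarefree_gt0.
  split=> //; apply: (pnat_coprime sq).
  by rewrite -coprime_pi'.
rewrite (perm_big [seq s * rho | s <- sqprods (primes q) & s * rho <= m]%N) /=.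
  rewrite big_map !big_filter big_seq_cond [RHS]big_seq_cond; apply: eq_bigr => s /andP[/sqpi[ss _ csr] _].
  rewrite totient_weightM// -mulrA /totient_weight srho mul1r mulVf ?mulr1//.
  by rewrite pnatr_eq0 -lt0n totient_gt0.
apply: uniq_perm; first by rewrite filter_uniq// iota_uniq.
  rewrite map_inj_uniq ?filter_uniq ?sqprods_uniq ?primes_uniq ?primes_all_prime//.
  by move=> x y /eqP; rewrite eqn_pmul2r// => /eqP.
move=> r; rewrite mem_filter mem_index_iota ltnS.
apply/idP/mapP => [/andP[/andP[/eqP <- sr] /andP[r0 rm]]|[s]].
  (* The inverse of the reindexing: s is the part of r made of primes dividing q. *)
  exists (r`_\pi(q))%N; last by rewrite partnC.
  rewrite mem_filter partnC// rm mem_sqprods ?primes_uniq ?primes_all_prime//=.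
  rewrite (squarefree_dvdn (dvdn_part _ _))//=.
  by apply/allP => p; rewrite primes_part mem_filter => /andP[].
rewrite mem_filter => /andP[sm /sqpi[ss sq csr]] ->.
rewrite sm squarefreeM// ss srho muln_gt0 squarefree_gt0// rho0 /= !andbT.
rewrite partnM// ?squarefree_gt0// part_p'nat ?mul1n; last by rewrite pnatNK.
by rewrite part_pnat_id// -coprime_pi'.
Qed.

(** Restricting to divisors prime to q replaces r and t by r' and t'. By [sum_moebius_gcd2] only
    pairs with t' = r' survive, each with the factor phi(r'), and the sum over those t is
    [sum_totient_weight_part] at rho = r'. *)
Lemma totient_weight_quadratic_form q m : (0 < q)%N ->
  \sum_(1 <= r < m.+1) \sum_(1 <= t < m.+1) w r * w t *
    (\sum_(d <- divisors r | coprime d q) \sum_(e <- divisors t | coprime e q)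
       (moebius d)%:~R * (moebius e)%:~R * (gcdn d e)%:R) =
  \sum_(1 <= r < m.+1) w r *
    \sum_(s <- sqprods (primes q) | (s * (coprime_part r q) <= m)%N) w s.
Proof.
move=> q0; apply: eq_big_nat => r /andP[r0 _].
have [sr|/negPf sr] := boolP (squarefree r); last first.
  have wr : w r = 0 by rewrite /totient_weight sr mul0r.
  by rewrite wr mul0r big1// => t _; rewrite !mul0r.
have srho : squarefree (coprime_part r q) by exact: squarefree_dvdn (dvdn_part _ _) _.
rewrite -sum_totient_weight_part//; last by rewrite coprime_pi'// part_pnat.
rewrite mulr_sumr [RHS]big_mkcond /=; apply: eq_big_nat => t /andP[t0 _].
have [st|/negPf st] := boolP (squarefree t); last first.
  by rewrite /totient_weight st !(mul0r, mulr0) if_same.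
rewrite sum_divisors_coprime//.
under eq_bigr do rewrite sum_divisors_coprime//.
rewrite sum_moebius_gcd2//; last exact: squarefree_dvdn (dvdn_part _ _) _.
by rewrite eq_sym; case: ifP; rewrite ?mulr0// mulrA.
Qed.

End TotientWeight.

(** The logarithm of s is the sum of log p over p | s, and the s divisible by p carry the proportion
    w(p)/(1 + w(p)) = 1/p of the total weight. *)
Lemma sum_totient_weight_ln (K : realType) ps : uniq ps -> all prime ps ->
  \sum_(s <- sqprods ps) totient_weight s * ln s%:R =
  (\sum_(s <- sqprods ps) totient_weight s) *
    \sum_(p <- ps) ln p%:R / p%:R :> K.
Proof.
elim: ps => [|p ps IH] ups aps; first by rewrite big_nil mulr0 big_seq1 ln1 mulr0.
have /andP[pps ups'] := ups; have /andP[pp aps'] := aps.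
rewrite /= !big_cat !big_map big_cons /=.
have H s : s \in sqprods ps -> coprime p s.
  by move=> sp; rewrite prime_coprime// (sqprods_ndvd ups aps).
have -> : \sum_(s <- sqprods ps) totient_weight (p * s)%N =
    (p%:R - 1)^-1 * \sum_(s <- sqprods ps) totient_weight s :> K.
  rewrite mulr_sumr !big_seq; apply: eq_bigr => s /H c.
  by rewrite totient_weightM// totient_weight_prime.
have -> : \sum_(s <- sqprods ps) totient_weight (p * s)%N * ln (p * s)%:R =
    (p%:R - 1)^-1 * (ln p%:R * \sum_(s <- sqprods ps) totient_weight s +
     \sum_(s <- sqprods ps) totient_weight s * ln s%:R) :> K.
  rewrite mulrDr mulrA !mulr_sumr -big_split /= !big_seq.
  apply: eq_bigr => s sp; rewrite totient_weightM ?H// totient_weight_prime//.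
  rewrite natrM lnM ?posrE ?ltr0n ?(sqprods_gt0 aps' sp) ?prime_gt0//.
  by rewrite mulrDr mulrAC; congr (_ + _); rewrite -mulrA.
rewrite IH//.
have H1 : p%:R - 1 != 0 :> K by rewrite subr_eq0 pnatr_eq1 gtn_eqF// prime_gt1.
have H2 : p%:R != 0 :> K by rewrite pnatr_eq0 -lt0n prime_gt0.
by field; rewrite H1 H2.
Qed.

(** * Interpolating Euler products *)

Lemma sum_dvdn (V : nmodType) (u : nat -> V) d n : (0 < d)%N ->
  \sum_(1 <= m < n.+1 | (d %| m)%N) u (m %/ d)%N =
  \sum_(1 <= m < (n %/ d).+1) u m.
Proof.
move=> d0; elim: n => [|n IH]; first by rewrite div0n !big_geq.
rewrite big_mkcond big_nat_recr//= -big_mkcond IH divnS//.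
case: (d %| n.+1)%N => /=; last by rewrite addr0.
by rewrite add1n [RHS]big_nat_recr.
Qed.

Lemma truncn_div (K : realType) (x : K) d : 0 <= x -> (0 < d)%N ->
  Num.truncn (x / d%:R) = (Num.truncn x %/ d)%N.
Proof.
move=> x0 d0; have d0' : 0 < d%:R :> K by rewrite ltr0n.
apply: truncn_def; rewrite ler_pdivlMr// ltr_pdivrMr// -!natrM.
by rewrite -truncn_ge_nat// leq_divM -truncn_lt_nat// ltn_ceil.
Qed.

Definition psum (K : realType) (u : nat -> K) (x : K) : K :=
  \sum_(1 <= m < (Num.truncn x).+1) u m.

(** Writes a summatory function at x/d as one at x, so that relations between summatory functions
    can be checked term by term. *)
Lemma psum_div (K : realType) (u : nat -> K) x d : 0 <= x -> (0 < d)%N ->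
  psum u (x / d%:R) =
  psum (fun m => if (d %| m)%N then u (m %/ d)%N else 0) x.
Proof. by move=> x0 d0; rewrite /psum truncn_div// -sum_dvdn// big_mkcond. Qed.

Section EulerLocal.
Variable K : realType.
Implicit Types (p m P : nat).

(* Local factor at p^j of the multiplicative function interpolating between
   1/m (P = 0) and mu^2(m)/phi(m) (P > m). *)
Definition euler_local P p j : K :=
  if (p < P)%N then
    match j with 0 => 1 | 1 => (p%:R - 1)^-1 | _ => 0 end
  else p%:R ^- j.

Definition interp P m : K := \prod_(p <- primes m) euler_local P p (logn p m).

Lemma euler_local0 P p : euler_local P p 0 = 1.
Proof. by rewrite /euler_local expr0 invr1 if_same. Qed.

(** A product over a range independent of m allows the values at m and at m/p^k to be compared
    factor by factor. *)
Lemma interpE P m M : (0 < m)%N -> (m < M)%N ->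
  interp P m = \prod_(0 <= p < M | prime p) euler_local P p (logn p m).
Proof.
move=> m0 mM; rewrite [RHS](bigID (fun p => p \in primes m)) /=.
rewrite [X in _ * X]big1 ?mulr1; last first.
  move=> p /andP[pp]; rewrite -logn_gt0 -eqn0Ngt => /eqP ->.
  exact: euler_local0.
rewrite -[RHS]big_filter; apply: perm_big; apply: uniq_perm.
- exact: primes_uniq.
- by rewrite filter_uniq// iota_uniq.
move=> p; rewrite mem_filter mem_index_iota mem_primes m0 /=.
case: (boolP (prime p)) => //= pp; case: (boolP (p %| m)%N) => //= pm.
by rewrite (leq_ltn_trans (dvdn_leq m0 pm)).
Qed.

Lemma interp0 m : (0 < m)%N -> interp 0 m = m%:R^-1.
Proof.
move=> m0; rewrite /interp {3}(prod_prime_decomp m0) prime_decompE big_map /=.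
rewrite natr_prod -prodfV; apply: eq_bigr => p _.
by rewrite /euler_local ltn0 natrX.
Qed.

Lemma interp_gt P m : (0 < m)%N -> (m < P)%N -> interp P m = totient_weight m.
Proof.
move=> m0 mP; have lt p : p \in primes m -> (p < P)%N.
  rewrite mem_primes => /and3P[_ _ pm].
  exact: leq_ltn_trans (dvdn_leq m0 pm) mP.
rewrite /totient_weight; case: (boolP (squarefree m)) => sm.
  rewrite totient_squarefree// natr_prod mul1r -prodfV /interp.
  rewrite !big_seq; apply: eq_bigr => p pm; rewrite /euler_local lt//.
  have pp : prime p by move: pm; rewrite mem_primes => /andP[].
  move: pm; rewrite -logn_gt0; move/squarefreeP : sm => [_ /(_ p pp)].
  case: logn => [|[|]]// _ _.
  by rewrite -{1}(prednK (prime_gt0 pp)) -natr1 addrK.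
rewrite mul0r /interp.
have [p pm l2] : exists2 p, p \in primes m & (1 < logn p m)%N.
  apply/hasP; apply: contraR sm; rewrite -all_predC => /allP H.
  apply/squarefreeP; split=> // p pp; rewrite leqNgt.
  case: (boolP (p \in primes m)) => [/H//|].
  by rewrite -logn_gt0 -leqNgt -ltnNge ltnS => /leq_trans; apply.
rewrite (big_rem p)//= /euler_local lt//.
by case: logn l2 => [|[|]]//; rewrite mul0r.
Qed.

Lemma interp_nonprime P m : ~~ prime P -> interp P.+1 m = interp P m.
Proof.
move=> nP; rewrite /interp !big_seq; apply: eq_bigr => p.
rewrite mem_primes => /andP[pp _]; rewrite /euler_local ltnS leq_eqVlt.
by case: eqP => // E; move: nP; rewrite -E pp.
Qed.

(** Only the factor at p changes. With j the exponent of p in m, the claim is trivial for j = 0; for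
    j = 1 it reads 1/p + 1/(p(p-1)) = 1/(p-1), and for j >= 2 it is p^(-j) (1 + (p - p^2)/(p(p-1)))
    = 0. *)
Lemma interp_step p m : prime p -> (0 < m)%N ->
  interp p.+1 m = interp p m + (p%:R * (p%:R - 1))^-1 *
    ((if (p %| m)%N then interp p (m %/ p) else 0) -
     (if (p ^ 2 %| m)%N then interp p (m %/ p ^ 2) else 0)).
Proof.
move=> pp m0; set j := logn p m.
(* The factors away from p, common to m and every m/p^k. The range reaches m + p so that it contains
   p even when p > m. *)
pose rest := \prod_(0 <= r < (m + p).+1 | prime r && (r != p))
  euler_local p r (logn r m).
have H k : (p ^ k %| m)%N -> interp p (m %/ p ^ k) = p%:R ^- (j - k) * rest.
  move=> pm.
  have mk0 : (0 < m %/ p ^ k)%N by rewrite divn_gt0 ?expn_gt0 ?prime_gt0// dvdn_leq.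
  rewrite (@interpE _ _ (m + p).+1)//; last first.
    by rewrite ltnS (leq_trans (leq_div _ _))// leq_addr.
  rewrite big_mkcond (bigD1_seq p) ?mem_index_iota ?iota_uniq//=; last first.
    by rewrite ltnS leq_addl.
  rewrite pp -big_mkcondr /euler_local ltnn logn_div// pfactorK//; congr (_ * _).
  rewrite /rest; apply: eq_big => [r|r /andP[rr rp]]; first by rewrite andbC.
  by rewrite logn_div// lognX (logn_prime r pp) (negPf rr) muln0 subn0.
have H1 : interp p.+1 m = euler_local p.+1 p j * rest.
  rewrite (@interpE _ _ (m + p).+1)//; last by rewrite ltnS leq_addr.
  rewrite big_mkcond (bigD1_seq p) ?mem_index_iota ?iota_uniq//=; last first.
    by rewrite ltnS leq_addl.
  rewrite pp -big_mkcondr; congr (_ * _).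
  rewrite /rest; apply: eq_big => [r|r /andP[rr rp]]; first by rewrite andbC.
  by rewrite /euler_local ltnS leq_eqVlt (negPf rr).
have := H 0%N; rewrite expn0 divn1 subn0 => -> //; rewrite H1.
have := H 1%N; have := H 2%N; rewrite expn1.
have -> : (p %| m)%N = (1 <= j)%N by rewrite -{1}(expn1 p) pfactor_dvdn.
have -> : (p ^ 2 %| m)%N = (2 <= j)%N by rewrite pfactor_dvdn.
rewrite /euler_local leqnn.
have p0 : p%:R != 0 :> K by rewrite pnatr_eq0 -lt0n prime_gt0.
have p1 : p%:R - 1 != 0 :> K by rewrite subr_eq0 pnatr_eq1 gtn_eqF// prime_gt1.
clear H H1; clearbody j; case: j => [|[|j]] /= H2 H3.
- by rewrite expr0 invr1 subrr mulr0 addr0.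
- by rewrite H3// subnn expr0 subr0 expr1; field; rewrite p0 p1.
rewrite H2// H3// !subSS !subn0 mul0r !exprS.
have pj : p%:R ^+ j != 0 :> K by rewrite expf_neq0.
by field; rewrite pj p0 p1.
Qed.

Lemma psum_interp_step p x : prime p -> 0 <= x ->
  psum (interp p.+1) x = psum (interp p) x + (p%:R * (p%:R - 1))^-1 *
    (psum (interp p) (x / p%:R) - psum (interp p) (x / p%:R ^+ 2)).
Proof.
move=> pp x0; have p0 := prime_gt0 pp.
rewrite -natrX !psum_div ?expn_gt0 ?p0// /psum -sumrB mulr_sumr -big_split /=.
by apply: eq_big_nat => m /andP[m0 _]; rewrite interp_step.
Qed.

End EulerLocal.
Arguments interp {K} P m.

(** * Asymptotics of the sum of the weights *)

Section Asymptotics.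
Variable K : realType.
Implicit Types (x d alpha : K) (n P : nat).

Lemma ln_le_sub1 x : 0 < x -> ln x <= x - 1.
Proof.
move=> x0; have -> : x = 1 + (x - 1) by ring.
have := @le_ln1Dx K (x - 1); rewrite ltrBrDl subrr => /(_ x0) /le_trans; apply.
by lra.
Qed.

Lemma ln_diff_bounds x y : 0 < x -> 0 < y -> 1 - x / y <= ln y - ln x <= y / x - 1.
Proof.
move=> x0 y0; rewrite -ln_div ?posrE//; apply/andP; split.
  rewrite -lerN2 -lnV ?posrE ?divr_gt0// invf_div opprB.
  exact: ln_le_sub1 (divr_gt0 x0 y0).
exact: ln_le_sub1 (divr_gt0 y0 x0).
Qed.

Lemma ln_succ_bounds n : (0 < n)%N ->
  n.+1%:R^-1 <= ln n.+1%:R - ln (n%:R : K) <= n%:R^-1.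
Proof.
move=> n0; have n0' : 0 < n%:R :> K by rewrite ltr0n.
have := ln_diff_bounds n0' (ltr0Sn K n).
have : (n.+1%:R : K) != 0 by rewrite pnatr_eq0.
rewrite -natr1; move: n0'; move: (n%:R : K) => y y0 y1.
have -> : 1 - y / (y + 1) = (y + 1)^-1 by field.
by have -> : (y + 1) / y - 1 = y^-1 by field; rewrite gt_eqF.
Qed.

(** * Harmonic sums and Euler's constant *)

Definition harmonic_sum n : K := \sum_(1 <= k < n.+1) k%:R^-1.

Lemma harmonic_sumS n : harmonic_sum n.+1 = harmonic_sum n + n.+1%:R^-1.
Proof. by rewrite /harmonic_sum big_nat_recr. Qed.

(** The sequence H_n - log n decreases and H_n - log(n+1) increases, so gamma lies between them;
    their gap log(n+1) - log n is at most 1/n. *)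
Lemma harmonic_sum_bound n : (0 < n)%N ->
  `|harmonic_sum n - ln n%:R - euler_gamma K| <= n%:R^-1.
Proof.
pose a n := harmonic_sum n - ln n%:R.
pose b n := harmonic_sum n - ln n.+1%:R.
have aS m : (0 < m)%N -> a m.+1 <= a m.
  move=> /ln_succ_bounds/andP[+ _]; rewrite /a harmonic_sumS.
  by move: (harmonic_sum m) (ln _) (ln _) (_^-1) => h u v t; lra.
have bS m : b m <= b m.+1.
  have /andP[_] := ln_succ_bounds (ltn0Sn m); rewrite /b harmonic_sumS.
  by move: (harmonic_sum m) (ln _) (ln _) (_^-1) => h u v t; lra.
have ba m : (0 < m)%N -> b m <= a m.
  by move=> m0; rewrite /a /b lerD2l lerN2 ler_ln ?posrE ?ltr0n// ler_nat.
(* The index is shifted because [aS] only starts at 1; the limit is unaffected. *)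
have a_mono : {homo (fun n => a n.+1) : n m / (n <= m)%N >-> m <= n}.
  by apply: homo_leq => [//|x y z /[swap]|m]; [exact: le_trans|exact: aS].
have b_mono : {homo b : n m / (n <= m)%N >-> n <= m}.
  by apply: homo_leq => [//|x y z|m]; [exact: le_trans|exact: bS].
have ab m k : b m <= a k.+1.
  apply: (le_trans (b_mono _ _ (leq_addr k.+1 m))).
  apply: (le_trans (ba _ _)); first by rewrite addnS.
  rewrite addnS; apply: a_mono; exact: leq_addl.
have acv : cvgn (fun n => a n.+1).
  apply: nonincreasing_is_cvgn => //; exists (b 0%N) => _ [k _ <-]; exact: ab.
have lim : euler_gamma K = limn (fun n => a n.+1).
  by apply: cvg_lim => //; rewrite -(cvg_shiftS a).
case: n => // n _; rewrite -[harmonic_sum _ - _]/(a n.+1) lim.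
have h1 := nonincreasing_cvgn_ge a_mono acv n.
have h2 : b n.+1 <= limn (fun n => a n.+1).
  by apply: limr_ge => //; apply: nearW => k; exact: ab.
rewrite ger0_norm ?subr_ge0//.
have /andP[_] := ln_succ_bounds (ltn0Sn n).
move: h1 h2; rewrite /b /a.
by move: (harmonic_sum _) (ln _) (ln _) (limn _) (_^-1) => h u v l t; lra.
Qed.

(** The range 0 < x < 1 is included because the recursion evaluates at x/p and x/p^2, which may fall
    below 1. There the sum is empty and log x + gamma itself is O(x^(-alpha)). *)
Lemma psum_inv_bound alpha : 0 < alpha <= 1 ->
  exists2 A : K, 0 <= A & forall x, 0 < x ->
    `|psum (fun m => m%:R^-1) x - (ln x + euler_gamma K)| <= A * x `^ (- alpha).
Proof.
(* For x < 1, |log x| <= x^(-alpha)/alpha and |gamma| account for the last two terms. For x >= 1 and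
   n the integer part of x, the error is at most 2/n <= 4/x <= 4 x^(-alpha). *)
move=> /andP[al0 al1]; exists (4 + alpha^-1 + `|euler_gamma K|).
  by rewrite !addr_ge0// ltW// invr_gt0.
move=> x x0; have [x1|x1] := leP 1 x; last first.
  have -> : psum (fun m => m%:R^-1) x = 0 :> K.
    by rewrite /psum (truncn0Pn _ _) ?big_geq// -ltNge.
  have xa1 : 1 <= x `^ (- alpha).
    rewrite -(powRr0 x); apply: ger_powR; first by rewrite x0 ltW.
    by rewrite oppr_le0 ltW.
  rewrite sub0r normrN (le_trans (ler_normD _ _))// !mulrDl.
  have lnx : `|ln x| <= alpha^-1 * x `^ (- alpha).
    rewrite ler0_norm; last by rewrite ln_le0// ltW.
    rewrite [leRHS]mulrC ler_pdivlMr//.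
    have := @ln_sublinear K (x `^ (- alpha)) (powR_gt0 _ x0).
    by rewrite ln_powR; lra.
  have h2 : `|euler_gamma K| <= `|euler_gamma K| * x `^ (- alpha).
    by rewrite ler_peMr.
  by have := powR_ge0 x (- alpha); lra.
pose n := Num.truncn x.
have n0 : (0 < n)%N by rewrite truncn_gt0.
have n0' : 0 < n%:R :> K by rewrite ltr0n.
have /andP[nx xn] : n%:R <= x < n.+1%:R by apply: truncn_itv; exact: ltW.
have h1 := harmonic_sum_bound n0.
have /andP[h2 h3] := ln_diff_bounds n0' x0.
have h4 : 0 <= ln x - ln n%:R by rewrite subr_ge0 ler_ln ?posrE.
have h5 : x / n%:R - 1 <= n%:R^-1.
  rewrite lerBlDr -[X in _ <= _ + X](divff (lt0r_neq0 n0')) -{2}(mul1r n%:R^-1) -mulrDl.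
  by rewrite ler_pM2r ?invr_gt0// addrC natr1 ltW.
have h6 : n%:R^-1 <= 2 * x^-1.
  rewrite ler_pdivlMr// mulrC ler_pdivrMr//.
  have : 1 <= n%:R :> K by rewrite ler1n.
  by move: xn; rewrite -natr1; lra.
have h7 : x^-1 <= x `^ (- alpha).
  by rewrite -powR_inv1 ?(ltW x0)//; apply: (ler_powR x1); rewrite lerN2.
have -> : psum (fun m => m%:R^-1) x = harmonic_sum n by [].
rewrite (_ : _ - _ = (harmonic_sum n - ln n%:R - euler_gamma K) - (ln x - ln n%:R)); last by ring.
rewrite (le_trans (ler_normB _ _))// (ger0_norm h4).
have h8 : 0 <= (alpha^-1 + `|euler_gamma K|) * x `^ (- alpha).
  by rewrite mulr_ge0 ?powR_ge0// addr_ge0// invr_ge0 ltW.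
rewrite -[4 + _ + _]addrA mulrDl; move: (le_trans h3 h5) h1 h6 h7 h8.
move: (n%:R^-1) (x^-1) ((alpha^-1 + `|euler_gamma K|) * x `^ (- alpha)).
move: (`|harmonic_sum n - ln n%:R - euler_gamma K|) (ln x - _) (x `^ _) => *.
lra.
Qed.

(** Bounds the growth of the error constant: with alpha = (1 - d)/2, each factor dominates 1 +
    (p^alpha + p^(2 alpha))/(p(p-1)). The case d = 1 serves again in [sum_trunc_ratio]. *)
Definition bound_prod d P : K :=
  \prod_(0 <= p < P | prime p) (1 + 4 * p%:R `^ (- (1 + d))).

Lemma bound_prodS d P : bound_prod d P.+1 =
  bound_prod d P * (if prime P then 1 + 4 * P%:R `^ (- (1 + d)) else 1).
Proof. by rewrite /bound_prod big_mkcond big_nat_recr//= -big_mkcond. Qed.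

Lemma bound_prod_ge0 d P : 0 <= bound_prod d P.
Proof. by apply: prodr_ge0 => p _; rewrite addr_ge0// mulr_ge0// powR_ge0. Qed.

(* The exponent telescopes, since d * n^(-1-d) <= (n-1)^(-d) - n^(-d). *)
Lemma bound_prod_le d P : 0 < d -> bound_prod d P <= expR (4 / d).
Proof.
move=> d0; case: P => [|P].
  by rewrite /bound_prod big_geq// -expR0 ler_expR ltW// divr_gt0.
case: P => [|P].
  by rewrite /bound_prod big_ltn_cond//= big_geq// -expR0 ler_expR ltW// divr_gt0.
(* Keeping the last term of the telescoping sum makes the bound inductive; at P = 0 both sides are
   1. *)
suff : bound_prod d P.+2 <= expR (4 / d * (1 - P.+1%:R `^ (- d))).
  move=> /le_trans; apply; rewrite ler_expR; apply: ler_piMr.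
    by rewrite divr_ge0// ltW.
  by rewrite gerBl powR_ge0.
elim: P => [|P IH].
  rewrite /bound_prod big_ltn_cond//= big_ltn_cond//= big_geq//.
  by rewrite powR1 subrr mulr0 expR0.
rewrite bound_prodS.
have h : 4 * P.+2%:R `^ (- (1 + d)) <= 4 / d * (P.+1%:R `^ (- d) - P.+2%:R `^ (- d)).
  rewrite -mulrA ler_pM2l// mulrC ler_pdivlMr//.
  rewrite opprD powRD ?pnatr_eq0 ?implybT// powR_inv1 ?ler0n//.
  have p1 : 0 < P.+1%:R :> K by rewrite ltr0n.
  have p2 : 0 < P.+2%:R :> K by rewrite ltr0n.
  (* The telescoping inequality follows from exp(t) >= 1 + t at t = d (log(P+2) - log(P+1)), where t
     >= d/(P+2). *)
  have -> : P.+1%:R `^ (- d) = expR (d * (ln P.+2%:R - ln P.+1%:R)) * P.+2%:R `^ (- d) :> K.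
    rewrite /powR !pnatr_eq0 -expRD; congr expR; ring.
  have h2 := expR_ge1Dx (d * (ln P.+2%:R - ln P.+1%:R)).
  have /andP[h3 _] := ln_succ_bounds (ltn0Sn P).
  rewrite -[X in _ <= _ - X]mul1r -mulrBl mulrAC ler_pM2r ?powR_gt0// mulrC.
  move: (ler_wpM2l (ltW d0) h3) h2.
  by move: (d * _) (expR _) (d / _) => *; lra.
case: ifP => _; last first.
  rewrite mulr1; apply: (le_trans IH).
  rewrite ler_expR ler_pM2l ?divr_gt0// lerD2l lerN2.
  have := powR_ge0 (P.+2%:R : K) (- (1 + d)).
  move: h; rewrite -subr_ge0 => h h0; rewrite -subr_ge0.
  rewrite -(pmulr_rge0 _ (divr_gt0 (ltr0n K 4) d0)); lra.
apply: (le_trans (ler_pM _ _ IH (expR_ge1Dx _))).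
- exact: bound_prod_ge0.
- by rewrite addr_ge0// mulr_ge0// powR_ge0.
rewrite -expRD ler_expR; lra.
Qed.

Definition prime_const P : K :=
  \sum_(0 <= p < P | prime p) ln p%:R / (p%:R * (p%:R - 1)).

Lemma prime_constS P : prime_const P.+1 =
  prime_const P + (if prime P then ln P%:R / (P%:R * (P%:R - 1)) else 0).
Proof. by rewrite /prime_const big_mkcond big_nat_recr//= -big_mkcond. Qed.

Lemma psum_interp_bound A d P : 0 < d < 1 -> 0 <= A ->
  (forall x, 0 < x -> `|psum (fun m => m%:R^-1) x - (ln x + euler_gamma K)| <=
                A * x `^ (- ((1 - d) / 2))) ->
  forall x, 0 < x ->
    `|psum (interp P) x - (ln x + euler_gamma K + prime_const P)| <=
    A * bound_prod d P * x `^ (- ((1 - d) / 2)).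
Proof.
move=> /andP[d0 d1] A0 H; elim: P => [|P IH] x x0.
  rewrite /bound_prod /prime_const !big_geq// mulr1 addr0.
  have -> : psum (interp 0) x = psum (fun m => m%:R^-1) x :> K.
    by apply: eq_big_nat => m /andP[m0 _]; rewrite interp0.
  exact: H.
rewrite bound_prodS prime_constS.
case: ifPn => pP; last first.
  rewrite addr0 mulr1 (_ : psum (interp P.+1) x = psum (interp P) x) ?IH//.
  by apply: eq_bigr => m _; rewrite interp_nonprime.
rewrite psum_interp_step ?(ltW x0)//.
set p : K := P%:R; set k := (p * (p - 1))^-1.
have p2 : 2 <= p by rewrite /p ler_nat prime_gt1.
have p0 : 0 < p by lra.
have k0 : 0 <= k by rewrite invr_ge0 mulr_ge0; lra.
have xp0 : 0 < x / p by rewrite divr_gt0.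
have xpp0 : 0 < x / p ^+ 2 by rewrite divr_gt0// exprn_gt0.
have e0 := IH x x0; have e1 := IH _ xp0; have e2 := IH _ xpp0.
set al := (1 - d) / 2 in e0 e1 e2 *.
set c := A * bound_prod d P in e0 e1 e2 *.
have c0 : 0 <= c by rewrite mulr_ge0// bound_prod_ge0.
have pw1 : (x / p) `^ (- al) = x `^ (- al) * p `^ al.
  by rewrite powRM ?invr_ge0 ?ltW// -powR_inv1 ?ltW// -powRrM mulN1r opprK.
have pw2 : (x / p ^+ 2) `^ (- al) = x `^ (- al) * p `^ (1 - d).
  rewrite powRM ?invr_ge0 ?exprn_ge0 ?ltW// -powR_inv1 ?exprn_ge0 ?ltW//.
  rewrite -powR_mulrn ?ltW// -!powRrM; congr (_ * _ `^ _).
  by rewrite /al; field.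
have ln1' : ln (x / p) = ln x - ln p by rewrite ln_div ?posrE.
have ln2 : ln (x / p ^+ 2) = ln x - ln p *+ 2 by rewrite ln_div ?posrE ?exprn_gt0// lnXn.
rewrite pw1 ln1' in e1; rewrite pw2 ln2 in e2.
set F0 := psum _ x in e0 *; set F1 := psum _ (x / p) in e1 *.
set F2 := psum _ (x / p ^+ 2) in e2 *.
set g := euler_gamma K in e0 e1 e2 *; set pc := prime_const P in e0 e1 e2 *.
(* The main terms at x/p and x/p^2 differ by log p, which produces the new summand of [prime_const].
   The three errors that remain are bounded by the induction hypothesis. *)
rewrite (_ : _ - _ = (F0 - (ln x + g + pc)) +
  k * ((F1 - (ln x - ln p + g + pc)) - (F2 - (ln x - ln p *+ 2 + g + pc)))); last first.
  rewrite -/k; ring.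
rewrite (le_trans (ler_normD _ _))// normrM (ger0_norm k0).
have e3 : `|F1 - (ln x - ln p + g + pc) - (F2 - (ln x - ln p *+ 2 + g + pc))| <=
   c * (x `^ (- al) * p `^ al) + c * (x `^ (- al) * p `^ (1 - d)).
  by apply: (le_trans (ler_normB _ _)); exact: lerD.
apply: (le_trans (lerD e0 (ler_wpM2l k0 e3))).
have pa : p `^ al <= p `^ (1 - d).
  by apply: ler_powR; [lra|rewrite /al; lra].
(* This is p/(p-1) <= 2 after extracting p^2 from p^(1-d). *)
have kp : k * (2 * p `^ (1 - d)) <= 4 * p `^ (- (1 + d)).
  have -> : p `^ (1 - d) = p ^+ 2 * p `^ (- (1 + d)).
    rewrite -powR_mulrn ?ltW// -powRD ?(gt_eqF p0) ?implybT//; congr (_ `^ _); lra.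
  rewrite mulrA [leLHS]mulrA; apply: ler_wpM2r; first exact: powR_ge0.
  have -> : k * (2 * p ^+ 2) = 2 * p / (p - 1).
    have pn0 : p != 0 by rewrite gt_eqF.
    have pn1 : p - 1 != 0 by rewrite gt_eqF//; lra.
    by rewrite /k; field; rewrite pn0 pn1.
  by rewrite ler_pdivrMr; lra.
have h : k * (p `^ al + p `^ (1 - d)) <= 4 * p `^ (- (1 + d)).
  apply: le_trans kp; rewrite ler_wpM2l//; lra.
rewrite [leLHS](_ : _ = c * x `^ (- al) * (1 + k * (p `^ al + p `^ (1 - d)))); last by ring.
rewrite [leRHS](_ : _ = c * x `^ (- al) * (1 + 4 * p `^ (- (1 + d)))); last first.
  rewrite /c; ring.
by apply: ler_wpM2l; rewrite ?lerD2l// mulr_ge0// powR_ge0.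
Qed.

(** For P > x the interpolating function agrees with w on the whole range and the error bound is
    uniform in P, so P may tend to infinity in the constant term. *)
Lemma psum_totient_weight_asymptotic d : 0 < d < 1 ->
  exists C : K, forall x, 0 < x ->
    `|psum totient_weight x - (ln x + constc K)| <= C * x `^ (- ((1 - d) / 2)).
Proof.
move=> /andP[d0 d1].
have al1 : 0 < (1 - d) / 2 <= 1 by apply/andP; split; lra.
have [A A0 HA] := psum_inv_bound al1.
exists (A * expR (4 / d)).
have main x P : 0 < x -> (Num.truncn x < P)%N ->
   `|psum totient_weight x - (ln x + euler_gamma K + prime_const P)| <=
      A * expR (4 / d) * x `^ (- ((1 - d) / 2)).
  move=> x0 xP; have -> : psum totient_weight x = psum (interp P) x :> K.
    apply: eq_big_nat => m /andP[m0 mx].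
    by rewrite interp_gt// (leq_trans mx).
  have d01 : 0 < d < 1 by rewrite d0.
  apply: (le_trans (psum_interp_bound P d01 A0 HA x0)).
  by rewrite ler_wpM2r ?powR_ge0// ler_wpM2l// bound_prod_le.
have pc_mono : {homo prime_const : n m / (n <= m)%N >-> n <= m}.
  apply: homo_leq => [//|x y z|m]; first exact: le_trans.
  rewrite prime_constS lerDl; case: ifP => // pm.
  have : 1 <= m%:R :> K by rewrite ler1n prime_gt0.
  move=> m1; rewrite divr_ge0 ?ln_ge0// mulr_ge0//; lra.
(* The sum over primes is bounded by the estimate itself at x = 1, applied at n + 2 so that P
   exceeds 1. *)
have pc_cvg : cvgn prime_const.
  apply: nondecreasing_is_cvgn => //.
  exists (psum totient_weight 1 - euler_gamma K + A * expR (4 / d)).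
  move=> _ [n _ <-]; apply: (le_trans (pc_mono _ _ (leq_addr 2 n))).
  have := @main 1 (n + 2)%N ltr01; rewrite truncn1 ln1 powR1 addn2 => /(_ isT).
  rewrite ler_norml; lra.
move=> x x0; have cE : constc K = euler_gamma K + limn prime_const by [].
have b P : (Num.truncn x < P)%N -> _ := main x P x0.
rewrite ler_norml; apply/andP; split.
  have : limn prime_const <= A * expR (4 / d) * x `^ (- ((1 - d) / 2)) +
     psum totient_weight x - (ln x + euler_gamma K).
    apply: limr_le => //; near=> P.
    have : (Num.truncn x < P)%N by near: P; exact: nbhs_infty_gt.
    move=> /b; rewrite ler_norml; lra.
  rewrite cE; lra.
have : - (A * expR (4 / d) * x `^ (- ((1 - d) / 2))) +
     psum totient_weight x - (ln x + euler_gamma K) <= limn prime_const.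
  apply: limr_ge => //; near=> P.
  have : (Num.truncn x < P)%N by near: P; exact: nbhs_infty_gt.
  move=> /b; rewrite ler_norml; lra.
rewrite cE; lra.
Unshelve. all: by end_near.
Qed.

End Asymptotics.

(** * Error terms *)

Section SigmaBound.
Variable K : realType.
Implicit Types (p n m P : nat).

(** For squarefree m, sigma(m)/phi(m) is the product of (p+1)/(p-1) = 1 + 2/(p-1) over p | m. Here
    only the primes below P are kept, so that they can be introduced one at a time. *)
Definition trunc_ratio P m : K :=
  \prod_(p <- primes m | (p < P)%N) (1 + 2 / (p%:R - 1)).

Lemma ratio_factor_ge1 p : prime p -> 1 <= 1 + 2 / (p%:R - 1) :> K.
Proof.
move=> pp; rewrite lerDl divr_ge0// subr_ge0 ler1n prime_gt0//.
Qed.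

Lemma trunc_ratio_ge0 P m : 0 <= trunc_ratio P m.
Proof.
rewrite /trunc_ratio big_seq_cond; apply: prodr_ge0 => p.
rewrite mem_primes => /andP[/andP[/ratio_factor_ge1 + _] _].
exact: le_trans.
Qed.

Lemma trunc_ratio_step P m : (0 < m)%N -> trunc_ratio P.+1 m =
  trunc_ratio P m * (if prime P && (P %| m)%N then 1 + 2 / (P%:R - 1) else 1).
Proof.
move=> m0; rewrite /trunc_ratio; have -> : prime P && (P %| m)%N = (P \in primes m).
  by rewrite mem_primes m0.
case: ifPn => Pm; last first.
  rewrite mulr1 big_seq_cond [RHS]big_seq_cond; apply: eq_bigl => p.
  rewrite ltnS leq_eqVlt; case: eqP => [->|//]; by rewrite (negPf Pm).
rewrite big_mkcond (bigD1_seq P) ?primes_uniq//= ltnSn mulrC; congr (_ * _).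
by rewrite -big_mkcondr; apply: eq_bigl => p; rewrite ltnS ltn_neqAle.
Qed.

Lemma trunc_ratio_div p m : prime p -> (0 < m)%N -> (p %| m)%N ->
  trunc_ratio p m = trunc_ratio p (m %/ p)%N.
Proof.
move=> pp m0 pm; have p0 := prime_gt0 pp.
have mp0 : (0 < m %/ p)%N by rewrite divn_gt0// dvdn_leq.
rewrite /trunc_ratio -big_filter -[RHS]big_filter; apply: perm_big.
apply: uniq_perm; rewrite ?filter_uniq ?primes_uniq// => r.
rewrite !mem_filter !mem_primes m0 mp0 /= -{1}(divnK pm).
case: ltnP => //= rp; case: (boolP (prime r)) => //= rr.
rewrite Euclid_dvdM// [(r %| p)%N]dvdn_prime2// (ltn_eqF rp) orbF//.
Qed.

(** Admitting a prime P adds 2/(P-1) times the sum over multiples of P, which is the previous sum up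
    to n/P. The bound thus grows by 1 + 2/(P(P-1)) <= 1 + 4/P^2, the factor of [bound_prod] at d =
    1. *)
Lemma sum_trunc_ratio P n :
  \sum_(1 <= m < n.+1) trunc_ratio P m <= bound_prod (1 : K) P * n%:R.
Proof.
elim: P n => [|P IH] n.
  rewrite /bound_prod big_geq// mul1r.
  rewrite (eq_bigr (fun=> 1)); last by move=> m _; rewrite /trunc_ratio big1_seq.
  by rewrite sumr_const_nat subn1 /= .
rewrite bound_prodS.
rewrite (eq_big_nat _ _ (F2 := fun m => trunc_ratio P m +
   (if prime P && (P %| m)%N then trunc_ratio P m * (2 / (P%:R - 1)) else 0))); last first.
  move=> m /andP[m0 _]; rewrite trunc_ratio_step//.
  by case: ifP => _; rewrite ?mulrDr mulr1 ?addr0.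
rewrite big_split /=; case: (boolP (prime P)) => pP /=; last first.
  by rewrite [X in _ + X]big1 ?addr0 ?mulr1//; exact: IH.
rewrite -big_mkcond /= -mulr_suml.
have P2 : 2 <= P%:R :> K by rewrite ler_nat prime_gt1.
have P0 := prime_gt0 pP.
have -> : \sum_(1 <= m < n.+1 | (P %| m)%N) trunc_ratio P m =
    \sum_(1 <= m < (n %/ P).+1) trunc_ratio P m.
  rewrite -sum_dvdn// big_nat_cond [RHS]big_nat_cond.
  by apply: eq_bigr => m /andP[/andP[m0 _] Pm]; exact: trunc_ratio_div.
have h1 := IH n; have h2 := IH (n %/ P)%N.
have b0 : 0 <= bound_prod (1 : K) P by exact: bound_prod_ge0.
have h3 : (n %/ P)%:R <= n%:R / P%:R :> K.
  by rewrite ler_pdivlMr ?ltr0n// -natrM ler_nat leq_divM.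
have h4 : 2 / (P%:R - 1) / P%:R <= 4 * P%:R `^ (- (1 + 1)) :> K.
  rewrite (_ : - (1 + 1) = - 2%:R); last by [].
  rewrite powR_invn ?ler0n//.
  rewrite -[leLHS]mulrA -invfM ler_pdivrMr; last by rewrite mulr_gt0//; lra.
  rewrite mulrAC ler_pdivlMr; last by rewrite exprn_gt0//; lra.
  rewrite expr2; nra.
have h5 : \sum_(1 <= m < (n %/ P).+1) trunc_ratio P m <=
    bound_prod (1 : K) P * (n%:R / P%:R).
  by apply: (le_trans h2); rewrite ler_wpM2l.
have c0 : 0 <= 2 / (P%:R - 1) :> K by rewrite divr_ge0//; lra.
apply: (le_trans (lerD h1 (ler_wpM2r c0 h5))).
rewrite [leLHS](_ : _ = bound_prod 1 P * (1 + 2 / (P%:R - 1) / P%:R) * n%:R); last by ring.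
by rewrite ler_wpM2r// ler_wpM2l// lerD2l.
Qed.

Lemma totient_weight_sigma m : (0 < m)%N ->
  totient_weight m * \sum_(d <- divisors m) d%:R <= trunc_ratio m.+1 m.
Proof.
move=> m0; case: (boolP (squarefree m)) => sm; last first.
  by rewrite /totient_weight (negPf sm) !mul0r trunc_ratio_ge0.
rewrite (perm_big _ (perm_divisors_sqprods sm)) /=.
rewrite sum_sqprods ?primes_uniq ?primes_all_prime//; last first.
  by move=> p s _ _ _; rewrite natrM.
rewrite /totient_weight sm mul1r totient_squarefree// natr_prod -prodfV -big_split /=.
rewrite /trunc_ratio big_seq [leRHS]big_seq_cond le_eqVlt; apply/orP; left.
apply/eqP; apply: eq_big => [p|p pm].
  case: (boolP (p \in primes m)) => //; rewrite mem_primes => /and3P[_ _ pm].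
  by rewrite ltnS dvdn_leq.
have pp : prime p by move: pm; rewrite mem_primes => /and3P[].
have -> : p.-1%:R = p%:R - 1 :> K.
  by rewrite -{2}(prednK (prime_gt0 pp)) -natr1 addrK.
have H : p%:R - 1 != 0 :> K by rewrite subr_eq0 pnatr_eq1 gtn_eqF// prime_gt1.
field; exact: H.
Qed.

(** The square of this linear bound yields the O(R^2) term. *)
Lemma sum_totient_weight_sigma n :
  \sum_(1 <= m < n.+1) totient_weight m * \sum_(d <- divisors m) d%:R
    <= expR 4 * n%:R :> K.
Proof.
apply: (@le_trans _ _ (\sum_(1 <= m < n.+1) trunc_ratio n.+1 m)); last first.
  apply: (le_trans (sum_trunc_ratio _ _)); rewrite ler_wpM2r//.
  by have := @bound_prod_le K 1 n.+1 ltr01; rewrite divr1.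
rewrite !big_nat; apply: ler_sum => m /andP[m0 mn].
(* Raising the truncation from m + 1 to n + 1 changes nothing, since the primes dividing m are at
   most m. *)
rewrite (le_trans (totient_weight_sigma m0))// le_eqVlt; apply/orP; left.
rewrite /trunc_ratio big_seq_cond [X in _ == X]big_seq_cond; apply/eqP; apply: eq_bigl => p.
case: (boolP (p \in primes m)) => //; rewrite mem_primes => /and3P[_ _ pm] /=.
by rewrite ltnS (dvdn_leq m0 pm) (leq_ltn_trans (dvdn_leq m0 pm) mn).
Qed.

End SigmaBound.

(** * Counting integers in residue classes *)

Lemma count_residue m b n : (b < m)%N ->
  (\sum_(0 <= k < n) (k %% m == b) = (n + (m - b.+1)) %/ m)%N.
Proof.
move=> bm; have m0 : (0 < m)%N by exact: leq_ltn_trans bm.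
elim: n => [|n IH].
  by rewrite big_geq// add0n divn_small// ltn_subrL m0.
rewrite big_nat_recr//= IH addSn divnS// addnC; congr (_ + _)%N.
(* The quotient increases exactly when m divides n + (m - b), that is, when n is congruent to b. *)
congr nat_of_bool; rewrite -addnS -subSn// subSS.
apply/eqP/idP => [<-|].
  by rewrite {1}(divn_eq n m) -addnA subnKC ?dvdn_add ?dvdn_mull// ltnW ?ltn_pmod.
move=> dv; have /eqP : (n + (m - b) + b == 0 + b %[mod m])%N.
  by rewrite eqn_modDr mod0n.
by rewrite -addnA (subnK (ltnW bm)) modnDr add0n (modn_small bm) => ->.
Qed.

Lemma count_residue_bound (K : realType) m b (x : K) : (b < m)%N -> 0 <= x ->
  `|\sum_(1 <= k < (Num.truncn x).+1) (k %% m == b)%N%:R - x / m%:R| <= 3.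
Proof.
move=> bm x0; set n := Num.truncn x.
have m0 : (0 < m)%N by exact: leq_ltn_trans bm.
have m0' : 0 < m%:R :> K by rewrite ltr0n.
have /andP[nx xn] : n%:R <= x < n.+1%:R by exact: truncn_itv.
(* The exact count c includes k = 0, unlike the wanted sum S, so S <= c <= S + 1. *)
have := count_residue n.+1 bm; rewrite big_ltn// => E.
set c := ((n.+1 + (m - b.+1)) %/ m)%N in E.
have h1 : (c * m <= n + m)%N.
  rewrite (leq_trans (leq_divM _ _))// addSn -addnS leq_add2l.
  by rewrite -subSn// subSS leq_subr.
have h2 : (n < c.+1 * m)%N.
  by apply: leq_trans (leq_addr (m - b.+1) _) (ltnW (ltn_ceil _ m0)).
rewrite -natr_sum.
set S := (\sum_(1 <= k < n.+1) (k %% m == b))%N in E *.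
have h3 : (S <= c)%N by rewrite -E leq_addl.
have h4 : (c <= S.+1)%N by rewrite -E -add1n leq_add2r; case: eqP.
have {}h1 : c%:R * m%:R <= n%:R + m%:R :> K by rewrite -natrM -natrD ler_nat.
have {}h2 : n%:R < (c%:R + 1) * m%:R :> K by rewrite natr1 -natrM ltr_nat.
have {}h3 : S%:R <= c%:R :> K by rewrite ler_nat.
have {}h4 : c%:R <= S%:R + 1 :> K by rewrite natr1 ler_nat.
have h5 : n.+1%:R <= (c%:R + 1) * m%:R :> K.
  by rewrite natr1 -natrM ler_nat -(ltr_nat K) natrM -natr1.
have h6 : x / m%:R <= c%:R + 1 by rewrite ler_pdivrMr// (le_trans (ltW xn)).
have h7 : c%:R <= x / m%:R + 1.
  rewrite -lerBlDr ler_pdivlMr// mulrBl mul1r; lra.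
by rewrite ler_norml; apply/andP; split; lra.
Qed.

(** If (l, q) = 1, the two conditions on k define a single class modulo lq by the Chinese remainder
    theorem. Otherwise no k qualifies: l | k and k = a mod q force l to be prime to q. *)
Lemma count_progression_bound (K : realType) a q l (x : K) :
  (0 < q)%N -> (0 < l)%N -> coprime a q -> 0 <= x ->
  `|\sum_(1 <= k < (Num.truncn x).+1 | k == a %[mod q]) (l %| k)%N%:R
    - (coprime l q)%:R * (x / (q%:R * l%:R))| <= 3.
Proof.
move=> q0 l0 caq x0; rewrite big_mkcond /=; have [clq|nclq] := boolP (coprime l q).
  pose b := (chinese l q 0 a %% (l * q))%N.
  rewrite mul1r -natrM mulnC; have blq : (b < l * q)%N by rewrite ltn_pmod ?muln_gt0 ?l0.
  have := count_residue_bound blq x0; congr (`|_ - _| <= _).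
  apply: eq_bigr => k _; have -> : (k %% (l * q) == b)%N = (k == chinese l q 0 a %[mod l * q])%N by [].
  rewrite chinese_remainder// chinese_modl// chinese_modr// mod0n -/(dvdn l k).
  by case: (k == a %[mod q])%N; rewrite ?andbT ?andbF.
rewrite mul0r subr0 big1 ?normr0// => k _; case: eqP => // ka.
case: (boolP (l %| k)%N) => // lk; case/negP: nclq; apply: coprime_dvdl lk _.
by rewrite -coprime_modl ka coprime_modl.
Qed.

(** * The second moment of lambda *)

Section Deficit.
Variable K : realType.

(** The difference is log s + O(1), and for s >= 2 the bounded term is absorbed since log s >= log
    2. If x/s < 1 the second sum is empty and log x <= log s is used instead. *)
Lemma psum_totient_weight_diff : exists2 C : K, 0 <= C &
  forall (x : K) (s : nat), 1 <= x -> (0 < s)%N ->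
    psum totient_weight x - psum totient_weight (x / s%:R) <= C * ln s%:R.
Proof.
have d01 : 0 < (2^-1 : K) < 1 by apply/andP; split; lra.
have [A HA] := psum_totient_weight_asymptotic d01.
have A0 : 0 <= A.
  have := HA 1 ltr01; rewrite powR1 mulr1; exact: le_trans.
have {}HA x : 1 <= x -> `|psum totient_weight x - (ln x + constc K)| <= A.
  move=> x1; apply: (le_trans (HA x (lt_le_trans ltr01 x1))).
  rewrite -[leRHS]mulr1 ler_wpM2l//.
  have e0 : - ((1 - 2^-1) / 2) <= 0 :> K by lra.
  by have := ler_powR x1 e0; rewrite powRr0.
have l2 : 0 < ln 2%:R :> K by rewrite ln_gt0// ltr1n.
have B0 : 0 <= A + A + `|constc K| by rewrite !addr_ge0.
exists (1 + (A + A + `|constc K|) / ln 2%:R).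
  by rewrite addr_ge0// divr_ge0// ltW.
move=> x [//|[|s]] x1 _; first by rewrite divr1 subrr ln1 mulr0.
have xp : 0 < x by lra.
have lns : ln 2%:R <= ln s.+2%:R :> K by rewrite ler_ln ?posrE ?ltr0n// ler_nat.
have h : A + A + `|constc K| <= (A + A + `|constc K|) / ln 2%:R * ln s.+2%:R.
  by rewrite mulrAC ler_pdivlMr// ler_wpM2l.
rewrite mulrDl mul1r; have := HA x x1; rewrite ler_norml => /andP[_ h1].
have cn := ler_norm (constc K); have cn' := lerNnormlW (lexx `|constc K|).
have [xs|xs] := leP 1 (x / s.+2%:R).
  have := HA _ xs; rewrite ln_div ?posrE ?ltr0n// ler_norml => /andP[h2 _].
  have c0 := normr_ge0 (constc K).
  move: h; set W := _ * ln s.+2%:R => h; clearbody W; lra.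
have -> : psum totient_weight (x / s.+2%:R) = 0 :> K.
  by rewrite /psum (truncn0Pn _ _) ?big_geq// -ltNge.
have h3 : ln x <= ln s.+2%:R.
  by rewrite ler_ln ?posrE ?ltr0n//; move: xs; rewrite ltr_pdivrMr ?ltr0n// mul1r => /ltW.
move: h; set W := _ * ln s.+2%:R => h; clearbody W; lra.
Qed.

(** As r' <= r, the condition s r' > x forces r > x/s. *)
Lemma weight_tail q s (x : K) : 0 <= x -> (0 < s)%N ->
  \sum_(1 <= r < (Num.truncn x).+1 | ~~ (s * coprime_part r q <= Num.truncn x)%N)
     totient_weight r
  <= psum totient_weight x - psum totient_weight (x / s%:R) :> K.
Proof.
move=> x0 s0; rewrite /psum truncn_div//; set m := Num.truncn x.
rewrite lerBrDr [leRHS](bigID (fun r => s * r <= m)%N) /=.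
rewrite [leRHS]addrC; apply: lerD; last first.
  rewrite (big_nat_widen _ _ m.+1) ?ltnS ?leq_div//=.
  rewrite le_eqVlt; apply/orP; left; apply/eqP; apply: eq_bigl => r.
  by rewrite ltnS leq_divRL// mulnC.
rewrite big_mkcond [leRHS]big_mkcond !big_nat /=; apply: ler_sum => r /andP[r0 _].
case: ifPn => [h|_]; last by case: ifP => // _; exact: totient_weight_ge0.
case: ifPn => // /negPn h'; case/negP: h; apply: leq_trans h'.
by rewrite leq_mul2l dvdn_leq ?orbT// dvdn_part.
Qed.

Lemma quadratic_form_deficit : exists2 C : K, 0 <= C &
  forall (q : nat) (R : K), (0 < q)%N -> 1 <= R ->
  exists2 D : K, 0 <= D <= C * v K q &
  \sum_(1 <= r < (Num.truncn R).+1) totient_weight r *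
    \sum_(s <- sqprods (primes q) | (s * coprime_part r q <= Num.truncn R)%N)
       totient_weight s
  = q%:R / (totient q)%:R * (psum totient_weight R - D).
Proof.
have [C C0 HC] := psum_totient_weight_diff; exists C => // q R q0 R1.
set m := Num.truncn R; set Q : K := q%:R / (totient q)%:R.
have Q0 : 0 < Q by rewrite divr_gt0// ltr0n ?totient_gt0.
(* T collects the pairs (r, s) removed by the constraint; dividing by q/phi(q) gives the deficit
   D. *)
pose T : K := \sum_(1 <= r < m.+1) totient_weight r *
  \sum_(s <- sqprods (primes q) | ~~ (s * coprime_part r q <= m)%N)
    totient_weight s.
exists (T / Q); last first.
  rewrite mulrBr mulrCA divff ?gt_eqF// mulr1 /Q -sum_totient_weight_primes//.
  rewrite mulr_sumr /T -sumrB; apply: eq_bigr => r _.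
  by rewrite [X in X * totient_weight r](bigID (fun s => s * coprime_part r q <= m)%N) /=; ring.
rewrite divr_ge0 ?(ltW Q0)//=; last first.
  apply: sumr_ge0 => r _; rewrite mulr_ge0 ?totient_weight_ge0//.
  by apply: sumr_ge0 => s _; exact: totient_weight_ge0.
rewrite ler_pdivrMr//.
have -> : C * v K q * Q = \sum_(s <- sqprods (primes q)) totient_weight s * (C * ln s%:R).
  under eq_bigr do rewrite mulrCA.
  rewrite -mulr_sumr sum_totient_weight_ln ?primes_uniq ?primes_all_prime//.
  by rewrite sum_totient_weight_primes// -/Q /v -mulrA [Q * _]mulrC.
(* Summing over r first lets the tail for each s be bounded by C log s. *)
have -> : T = \sum_(s <- sqprods (primes q)) totient_weight s *
   \sum_(1 <= r < m.+1 | ~~ (s * coprime_part r q <= m)%N) totient_weight r.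
  rewrite /T; under eq_bigr do rewrite mulr_sumr big_mkcond.
  rewrite exchange_big /=; apply: eq_bigr => s _.
  rewrite mulr_sumr [RHS]big_mkcond /=; apply: eq_bigr => r _.
  by case: ifP => // _; rewrite mulrC.
rewrite !big_seq; apply: ler_sum => s sq; rewrite ler_wpM2l ?totient_weight_ge0//.
have s0 := sqprods_gt0 (primes_all_prime q) sq.
apply: le_trans (HC R s R1 s0); apply: weight_tail => //; lra.
Qed.

End Deficit.

(** * Expanding the square *)

Section LambdaSquare.
Variable K : realType.

(** Here k enters only through an indicator of divisibility, so it can be summed first after
    squaring. *)
Lemma lambdaE (R : K) k : lambda R k =
  \sum_(1 <= r < (Num.truncn R).+1) totient_weight r *
    \sum_(d <- divisors r) d%:R * (moebius d)%:~R * (d %| k)%N%:R.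
Proof.
rewrite /lambda big_nat [RHS]big_nat; apply: eq_bigr => r /andP[r0 _].
rewrite moebius_sqr; congr (_ * _).
have g0 : (0 < gcdn r k)%N by rewrite gcdn_gt0 r0.
rewrite (perm_big [seq d <- divisors r | d %| k]%N) /=; last first.
  apply: uniq_perm; rewrite ?filter_uniq ?divisors_uniq// => d.
  by rewrite mem_filter -!dvdn_divisors// dvdn_gcd andbC.
rewrite big_filter big_mkcond /=; apply: eq_bigr => d _.
by case: (d %| k)%N; rewrite ?mulr1 ?mulr0.
Qed.

Lemma sum_lambda_sqr (R : K) (P : pred nat) n :
  \sum_(1 <= k < n.+1 | P k) lambda R k ^+ 2 =
  \sum_(1 <= r < (Num.truncn R).+1) \sum_(1 <= t < (Num.truncn R).+1)
    totient_weight r * totient_weight t *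
    \sum_(d <- divisors r) \sum_(e <- divisors t)
      d%:R * (moebius d)%:~R * (e%:R * (moebius e)%:~R) *
      \sum_(1 <= k < n.+1 | P k) (lcmn d e %| k)%N%:R.
Proof.
under eq_bigr do rewrite lambdaE expr2 big_distrlr /=.
rewrite exchange_big /=; apply: eq_bigr => r _.
rewrite exchange_big /=; apply: eq_bigr => t _.
under eq_bigr do rewrite mulrACA big_distrlr /=.
rewrite -mulr_sumr; congr (_ * _).
rewrite exchange_big /=; apply: eq_bigr => d _.
rewrite exchange_big /=; apply: eq_bigr => e _.
rewrite mulr_sumr; apply: eq_bigr => k _.
by rewrite mulrACA -natrM mulnb -dvdn_lcm.
Qed.

Lemma normr_moebius_le1 d : `|(moebius d)%:~R| <= 1 :> K.
Proof.
rewrite /moebius; case: ifP => _; last by rewrite normr0.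
by rewrite rmorphXn rmorphN1 normrX normrN1 expr1n.
Qed.

Lemma coprime_lcml d e q : coprime (lcmn d e) q = coprime d q && coprime e q.
Proof.
apply/idP/andP => [H|[Hd He]].
  by split; apply: coprime_dvdl H; rewrite ?dvdn_lcml ?dvdn_lcmr.
apply: (@coprime_dvdl _ (d * e)); last by rewrite coprimeMl Hd.
by rewrite dvdn_lcm dvdn_mulr ?dvdn_mull.
Qed.

(** Uses de/[d, e] = (d, e), and that [d, e] is prime to q exactly when d and e both are. *)
Lemma sum_divisors_main_term (N : K) q r t : (0 < q)%N -> (0 < r)%N -> (0 < t)%N ->
  N / q%:R *
    (\sum_(d <- divisors r | coprime d q) \sum_(e <- divisors t | coprime e q)
       (moebius d)%:~R * (moebius e)%:~R * (gcdn d e)%:R) =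
  \sum_(d <- divisors r) \sum_(e <- divisors t)
    d%:R * (moebius d)%:~R * (e%:R * (moebius e)%:~R) *
      ((coprime (lcmn d e) q)%:R * (N / (q%:R * (lcmn d e)%:R))).
Proof.
move=> q0 r0 t0; rewrite mulr_sumr big_mkcond /= !big_seq; apply: eq_bigr => d.
rewrite -dvdn_divisors// => dr; have d0 := dvdn_gt0 r0 dr.
under [RHS]eq_bigr do rewrite coprime_lcml.
case: (coprime d q) => /=; last first.
  by rewrite big1// => e _; rewrite mul0r mulr0.
rewrite mulr_sumr big_mkcond /= !big_seq; apply: eq_bigr => e.
rewrite -dvdn_divisors// => et; have e0 := dvdn_gt0 t0 et.
case: (coprime e q) => /=; last by rewrite mul0r mulr0.
have q1 : q%:R != 0 :> K by rewrite pnatr_eq0 -lt0n.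
have l1 : (lcmn d e)%:R != 0 :> K by rewrite pnatr_eq0 -lt0n lcmn_gt0 d0.
have E : d%:R * e%:R = (lcmn d e)%:R * (gcdn d e)%:R :> K.
  by rewrite -!natrM muln_lcm_gcd.
by rewrite mul1r [X in _ = X * _]mulrACA E; field; rewrite q1 l1.
Qed.

Lemma sum_lambda_sqr_progression (a q : nat) (N R : K) :
  (0 < q)%N -> coprime a q -> 0 <= N -> 0 <= R ->
  `|\sum_(1 <= k < (Num.truncn N).+1 | k == a %[mod q]) lambda R k ^+ 2 -
   N / q%:R * \sum_(1 <= r < (Num.truncn R).+1) totient_weight r *
    \sum_(s <- sqprods (primes q) | (s * coprime_part r q <= Num.truncn R)%N)
       totient_weight s| <= 3 * expR 4 ^+ 2 * R ^+ 2.
Proof.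
move=> q0 caq N0 R0; rewrite sum_lambda_sqr -totient_weight_quadratic_form//.
set m := Num.truncn R; set n := Num.truncn N.
(* Each pair (d, e) costs at most 3de in counting, since |mu| <= 1. The total error then factors as
   3 S^2. *)
pose S := \sum_(1 <= r < m.+1) totient_weight r * \sum_(d <- divisors r) d%:R : K.
have S0 : 0 <= S.
  apply: sumr_ge0 => r _; rewrite mulr_ge0 ?totient_weight_ge0//.
  by apply: sumr_ge0.
have SR : S <= expR 4 * R.
  apply: (le_trans (sum_totient_weight_sigma K m)).
  by rewrite ler_wpM2l ?expR_ge0// truncn_le.
apply: (@le_trans _ _ (3 * (S * S))); last first.
  rewrite -mulrA -exprMn expr2 ler_wpM2l//.
  by apply: ler_pM.
rewrite [X in _ - X]mulr_sumr -sumrB /S big_distrlr [leRHS]mulr_sumr.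
apply: (le_trans (ler_norm_sum _ _ _)); apply: ler_sum_nat => r /andP[r0 _].
rewrite [X in _ - X]mulr_sumr -sumrB [leRHS]mulr_sumr.
apply: (le_trans (ler_norm_sum _ _ _)); apply: ler_sum_nat => t /andP[t0 _].
rewrite [X in _ - X]mulrCA -mulrBr normrM ger0_norm; last first.
  by rewrite mulr_ge0 ?totient_weight_ge0.
rewrite [X in _ <= 3 * X]mulrACA [leRHS]mulrCA.
rewrite ler_wpM2l ?mulr_ge0 ?totient_weight_ge0//.
rewrite sum_divisors_main_term// -sumrB big_distrlr [leRHS]mulr_sumr.
apply: (le_trans (ler_norm_sum _ _ _)); rewrite !big_seq.
apply: ler_sum => d; rewrite -dvdn_divisors// => dr; have d0 := dvdn_gt0 r0 dr.
rewrite -sumrB [leRHS]mulr_sumr; apply: (le_trans (ler_norm_sum _ _ _)).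
rewrite !big_seq.
apply: ler_sum => e; rewrite -dvdn_divisors// => et; have e0 := dvdn_gt0 t0 et.
have l0 : (0 < lcmn d e)%N by rewrite lcmn_gt0 d0.
rewrite -mulrBr normrM mulrC; apply: ler_pM => //.
  exact: count_progression_bound.
rewrite !normrM !normr_nat mulrACA; apply: ler_piMr; first exact: mulr_ge0.
by apply: mulr_ile1; rewrite ?normr_ge0 ?normr_moebius_le1.
Qed.

End LambdaSquare.

(** Replaces the integer residue a by its natural representative, for which the counting lemmas are
    stated. *)
Lemma eqz_mod_absz (q n : nat) (a : int) : (0 < q)%N ->
  (n%:Z == a %[mod q%:Z])%Z = (n == `|(a %% q%:Z)%Z| %[mod q])%N.
Proof.
move=> q0; have q1 : q%:Z != 0 by rewrite -lt0n.
have E : (a %% q%:Z = `|(a %% q%:Z)%Z|%N%:Z %% q%:Z)%Z.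
  by rewrite gez0_abs ?modz_ge0// modz_mod.
by rewrite {1}E !modz_nat.
Qed.

Lemma v_ge0 (K : realType) q : 0 <= v K q.
Proof.
rewrite /v big_seq; apply: sumr_ge0 => p; rewrite mem_primes => /andP[pp _].
by rewrite divr_ge0// ln_ge0// ler1n prime_gt0.
Qed.

Theorem proposition3 (K : realType) (epsilon : K) (epsilon_gt0 : 0 < epsilon) :
  exists C : K, forall (q : nat) (a : int) (N R : K),
    (1 <= q)%N -> coprimez a q%:Z -> 1 <= N -> 1 <= R ->
    exists E1 E2 E3 : K,
      [/\ `|E1| <= C * v K q,
          `|E2| <= C * R `^ (- 2^-1 + epsilon),
          `|E3| <= C * R ^+ 2 &
          \sum_(1 <= n < (Num.truncn N).+1 | (n%:Z == a %[mod q%:Z])%Z)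
             lambda R n ^+ 2 =
          N / (totient q)%:R * (ln R + constc K + E1 + E2) + E3].
Proof.
have [C1 C10 H1] := quadratic_form_deficit K.
(* The exponent -(1 - d)/2 = -1/2 + d/2 is at most -1/2 + epsilon; the cap 1/2 keeps d < 1. *)
pose d := Num.min (2 * epsilon) 2^-1.
have d01 : 0 < d < 1.
  by rewrite lt_min gt_min; apply/andP; split; [apply/andP; split|apply/orP; right]; lra.
have de : d <= 2 * epsilon by rewrite ge_min lexx.
have [C2 H2] := psum_totient_weight_asymptotic d01.
have C20 : 0 <= C2.
  by have := H2 1 ltr01; rewrite powR1 mulr1; exact: le_trans.
pose C3 : K := 3 * expR 4 ^+ 2.
have C30 : 0 <= C3 by rewrite mulr_ge0// exprn_ge0// expR_ge0.
exists (C1 + C2 + C3) => q a N R q0 caq N1 R1.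
pose b := `|(a %% q%:Z)%Z|%N.
have cbq : coprime b q.
  have : coprimez (a %% q%:Z)%Z q%:Z by rewrite /coprimez gcdz_modl.
  by [].
have R0 : 0 < R by lra.
have [D /andP[D0 D1] HD] := H1 q R q0 R1.
have H3 := sum_lambda_sqr_progression q0 cbq (le_trans ler01 N1) (ltW R0).
rewrite HD in H3; set S := \sum_(_ <= _ < _ | _) _ in H3.
set M := _ * _ in H3.
(* The errors are, in order, the deficit from the constraint, the error in the asymptotics of G(R),
   and the counting error. *)
exists (- D), (psum totient_weight R - (ln R + constc K)), (S - M); split.
- rewrite normrN ger0_norm// (le_trans D1)// ler_wpM2r ?v_ge0//; lra.
- apply: (le_trans (H2 R R0)); apply: ler_pM; rewrite ?powR_ge0//; first lra.
  by apply: ler_powR => //; lra.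
- apply: (le_trans H3); rewrite ler_wpM2r ?exprn_ge0 ?(ltW R0)// /C3; lra.
have -> : \sum_(1 <= n < (Num.truncn N).+1 | (n%:Z == a %[mod q%:Z])%Z) lambda R n ^+ 2 = S.
  by apply: eq_bigl => n; rewrite eqz_mod_absz.
have q1 : q%:R != 0 :> K by rewrite pnatr_eq0 -lt0n.
have f1 : (totient q)%:R != 0 :> K by rewrite pnatr_eq0 -lt0n totient_gt0.
by rewrite /M; field; rewrite q1 f1.
Qed.
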